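(* Let $q=p^{r}$ where $p$ is an odd prime and $r$ is a positive integer. If $\rho(q)=1/2$, then the cyclotomic polynomial $\Phi_{2p}$ is a double factor of the descent set polynomial $Q_{2q}(t)$, that is, $\Phi_{2p}^2$ divides $Q_{2q}(t)$.
   Context: For a permutation $\pi$ in the symmetric group $\mathfrak{S}_n$, its descent set is $\mathrm{Des}(\pi)=\{i\in[n-1] : \pi_i>\pi_{i+1}\}$, where $[n-1]=\{1,\dots,n-1\}$. For $S\subseteq[n-1]$ let $\beta_n(S)=|\{\pi\in\mathfrak{S}_n : \mathrm{Des}(\pi)=S\}|$. The $n$th descent set polynomial is $Q_n(t)=\sum_{S\subseteq[n-1]}t^{\beta_n(S)}$. The proportion of odd descent set statistics is $\rho(n)=|\{S\subseteq[n-1] : \beta_n(S)\equiv 1 \bmod 2\}|/2^{n-1}$. $\Phi_m(t)$ denotes the $m$th cyclotomic polynomial; factors are in $\mathbb{Q}[t]$. *)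

(* Defs.v *)
From mathcomp Require Import all_boot all_order all_fingroup all_algebra all_field.

Set Implicit Arguments.
Unset Strict Implicit.
Unset Printing Implicit Defensive.

Import GRing.Theory.
Local Open Scope ring_scope.

(* Permutations act on {0, ..., n-1} and i : 'I_n.-1 stands for the position   *)
(* i + 1 of [n-1]: the two adjacent positions it compares are, 0-based, i and  *)
(* i + 1.                                                                     *)
Fact adj_proof n (i : 'I_n.-1) : (i.+1 < n)%N.
Proof. by rewrite -ltn_predRL. Qed.

Definition adjl n (i : 'I_n.-1) : 'I_n := Ordinal (ltnW (adj_proof i)).
Definition adjr n (i : 'I_n.-1) : 'I_n := Ordinal (adj_proof i).

Definition Des n (s : 'S_n) : {set 'I_n.-1} :=
  [set i : 'I_n.-1 | (s (adjr i) < s (adjl i))%N].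

Definition beta n (S : {set 'I_n.-1}) : nat := #|[set s : 'S_n | Des s == S]|.

Definition descent_poly (n : nat) : {poly rat} :=
  \sum_(S : {set 'I_n.-1}) 'X^(beta S).

Definition rho (n : nat) : rat :=
  #|[set S : {set 'I_n.-1} | odd (beta S)]|%:R / 2 ^+ n.-1.

(* The library's 'Phi_m has integer coefficients. *)
Definition Phi (m : nat) : {poly rat} := map_poly (intr : int -> rat) ('Phi_m).

(* Main.v *)
Require Import Defs.
From mathcomp Require Import all_boot all_order all_fingroup all_algebra all_field.
From mathcomp Require Import zify ring.

(* Splitting a permutation at position t gives                                *)
(* beta_n(S) + beta_n(S xor {t}) = C(n, t) beta_t(S') beta_(n-t)(S''). Modulo *)
(* p this makes beta_2q(S) congruent to (-1)^|S \ {q}|, and modulo 2 it makes *)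
(* beta_2q(S) congruent to beta_q({j : 2j in S}). Hence h(S) = (-1)^beta_2q(S) *)
(* depends only on the even elements of S, and rho(q) = 1/2 says that it sums *)
(* to 0: its Fourier transform on the cube of subsets is supported on the     *)
(* nonempty sets X of even positions.                                         *)
(*   Modulo (t^p + 1)^2, a multiple of Phi_2p^2, Q_2q vanishes as soon as h   *)
(* and beta_2q h sum to 0 over each class of S with |S \ {q}| of fixed parity.*)
(* By Parseval this reduces to the vanishing, for Y = X and                   *)
(* Y = X xor ([2q-1] \ {q}), of the sum over all permutations of              *)
(* (-1)^|Des cap Y|. Such a Y has a maximal run of consecutive elements of    *)
(* odd length, and reversing the corresponding block of the permutation       *)
(* changes the sign.                                                          *)

(** With u = t^p + 1 and b = p k + d, the power t^b = t^d (u - 1)^k is congruent to (-1)^k t^d (1 -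
    k u) modulo u^2. Over a family of exponents b with the same residue d, the sum of the t^b is
    thus divisible by u^2 once (-1)^k and (-1)^k k sum to 0; as p is odd, it suffices that (-1)^b
    and (-1)^b b do ([Xn_plus1_sqr_dvd_sum]). The families are the two classes of sets S, on which
    beta_2q(S) is constantly 1 or -1 modulo p ([natr_beta_pat_double_ppow]). Both sums vanish there
    by Parseval ([sum_mul_eq0_chi]): each Fourier coefficient is zero either for h, by
    [odd_beta_pat_double] and the hypothesis on rho, or for the other factor, by orthogonality of
    characters in the first sum and by the sign-reversing flip of [sum_chi_Des_eq0] in the
    second. *)

Set Implicit Arguments.
Unset Strict Implicit.
Unset Printing Implicit Defensive.

Import GRing.Theory Num.Theory.

(** * Descent patterns and the splitting recurrence *)

Definition pattern n (f : 'I_n -> nat) (D : nat -> bool) : bool :=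
  [forall i : 'I_n.-1, (f (adjr i) < f (adjl i)) == D i].

(* Patterns are predicates on nat, and not sets of ordinals, so that the same
   pattern can be read on permutations of different lengths. *)
Definition beta_pat n (D : nat -> bool) : nat :=
  #|[set s : 'S_n | pattern (fun i => s i) D]|.

Definition toggle (k : nat) (D : nat -> bool) (i : nat) : bool := (i == k) (+) D i.

Lemma eq_pattern n (f g : 'I_n -> nat) (D E : nat -> bool) :
  (forall i j, (f i < f j) = (g i < g j)) -> (forall i, i < n.-1 -> D i = E i) ->
  pattern f D = pattern g E.
Proof. by move=> fg DE; apply: eq_forallb => i; rewrite fg DE. Qed.

Lemma eq_beta_pat n (D E : nat -> bool) :
  (forall i, i < n.-1 -> D i = E i) -> beta_pat n D = beta_pat n E.
Proof. by move=> DE; apply: eq_card => s; rewrite !inE; apply: eq_pattern. Qed.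

Lemma patternP n (f : 'I_n -> nat) (D : nat -> bool) :
  reflect (forall i j : 'I_n, j = i.+1 :> nat -> (f j < f i) = D i) (pattern f D).
Proof.
apply: (iffP forallP) => [fD i j ji|fD i]; last by apply/eqP/fD.
have lti : i < n.-1 by case: n i j ji {f fD} => [[]//|n] i j ji; rewrite /= -ltnS -ji.
have /eqP <- := fD (Ordinal lti).
by congr (f _ < f _); apply: val_inj.
Qed.

(** The rank of [f i] among the values of [f] serves as [r i]. This lets a block of a permutation be
    read as a permutation of the block's length. *)
Lemma standardization n (f : 'I_n -> nat) :
  injective f -> exists r : 'S_n, forall i j, (f i < f j) = (r i < r j).
Proof.
move=> f_inj; pose h (i : 'I_n) := #|[set j | f j < f i]|.
have h_lt i : h i < n.
  rewrite -[X in _ < X]card_ord -cardsT; apply: proper_card.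
  by apply/properP; split; [apply/subsetP | exists i; rewrite ?inE ?ltnn].
have h_mono i j : f i < f j -> h i < h j.
  move=> ltij; apply: proper_card; apply/properP; split.
    by apply/subsetP=> k; rewrite !inE => /ltn_trans; apply.
  by exists i; rewrite !inE ?ltnn.
have hE i j : (h i < h j) = (f i < f j).
  case: (ltngtP (f i) (f j)) => [/h_mono //|/h_mono|/f_inj ->]; last by rewrite ltnn.
  by case: ltngtP.
have r_inj : injective (fun i => Ordinal (h_lt i)).
  move=> i j /(congr1 val) /= hij; apply: f_inj; apply/eqP.
  by rewrite eqn_leq (leqNgt (f i)) (leqNgt (f j)) -!hE hij ltnn.
exists (perm r_inj) => i j. by rewrite !permE /= -hE.
Qed.

Lemma card_pattern_perm n (f : 'I_n -> nat) (D : nat -> bool) :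
  injective f -> #|[set s : 'S_n | pattern (fun i => f (s i)) D]| = beta_pat n D.
Proof.
move=> /standardization [r fr].
rewrite -(card_imset _ (@mulIg _ r)); apply: eq_card => s.
rewrite inE; apply/imsetP/idP => [[u] | sD].
  rewrite inE => uD ->; rewrite -(eq_pattern (f := fun i => f (u i)) (D := D)) //.
  by move=> i j; rewrite fr !permM.
exists (s * r^-1)%g; last by rewrite mulgKV.
rewrite inE (eq_pattern (g := fun i => s i) (E := D)) // => i j.
by rewrite fr !permM !permKV.
Qed.

Section Split.
Variables t m : nat.

Definition block_fun (st : 'S_t * 'S_m) (i : 'I_(t + m)) : 'I_(t + m) :=
  match split i with inl j => lshift m (st.1 j) | inr j => rshift t (st.2 j) end.

Lemma block_fun_inj st : injective (block_fun st).
Proof.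
move=> i j; rewrite /block_fun -{2}[i]splitK -{2}[j]splitK.
case: (split i) => i'; case: (split j) => j' /=.
- by move/lshift_inj/perm_inj->.
- by move/eqP; rewrite eq_lrshift.
- by move/eqP; rewrite eq_rlshift.
- by move/rshift_inj/perm_inj->.
Qed.

Definition block_perm st : 'S_(t + m) := perm (@block_fun_inj st).

Lemma block_perm_lshift st i : block_perm st (lshift m i) = lshift m (st.1 i).
Proof. by rewrite permE /block_fun (unsplitK (inl i)). Qed.

Lemma block_perm_rshift st i : block_perm st (rshift t i) = rshift t (st.2 i).
Proof. by rewrite permE /block_fun (unsplitK (inr i)). Qed.

Definition split_patterns (D E : nat -> bool) : {set 'S_(t + m)} :=
  [set s : 'S_(t + m) | pattern (fun i => s (lshift m i)) D && pattern (fun i => s (rshift t i)) E].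

(* Double count the pairs of a permutation and a rearrangement of its two blocks
   that gives both blocks the required pattern. *)
Lemma card_split_patterns D E :
  #|split_patterns D E| = 'C(t + m, t) * (beta_pat t D * beta_pat m E).
Proof.
(* In [(block_perm st * s)%g] the block permutation acts first, hence on positions. For fixed [s],
   the two blocks are rearranged independently. *)
have eq1 : \sum_(s : 'S_(t + m)) \sum_(st : 'S_t * 'S_m)
    ((block_perm st * s)%g \in split_patterns D E : nat)
  = (t + m)`! * (beta_pat t D * beta_pat m E).
  rewrite -[in RHS]card_Sn -cardsT -sum_nat_const.
  rewrite [LHS](eq_bigl (fun s => s \in [set: 'S_(t + m)])); last by move=> s; rewrite inE.
  apply: eq_bigr => s _.
  have sl_inj : injective (fun i => val (s (lshift m i))).
    by move=> i j /val_inj/perm_inj/lshift_inj.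
  have sr_inj : injective (fun i => val (s (rshift t i))).
    by move=> i j /val_inj/perm_inj/rshift_inj.
  rewrite -(card_pattern_perm D sl_inj) -(card_pattern_perm E sr_inj) -cardsX.
  rewrite -sum1_card [RHS]big_mkcond /=; apply: eq_bigr => -[s1 s2] _.
  rewrite !inE /=.
  rewrite -(eq_pattern (f := fun i => s (lshift m (s1 i))) (D := D)) //; last first.
    by move=> i j; rewrite !permM !block_perm_lshift.
  rewrite -(eq_pattern (f := fun i => s (rshift t (s2 i))) (D := E)) //; last first.
    by move=> i j; rewrite !permM !block_perm_rshift.
(* For fixed [st], left multiplication is a bijection, so every rearrangement contributes the same
   number. *)
have eq2 : \sum_(s : 'S_(t + m)) \sum_(st : 'S_t * 'S_m)
    ((block_perm st * s)%g \in split_patterns D E : nat)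
  = (t`! * m`!) * #|split_patterns D E|.
  rewrite exchange_big /= -!card_Sn -!cardsT -cardsX -sum_nat_const.
  rewrite [LHS](eq_bigl (fun st => st \in setX [set: 'S_t] [set: 'S_m])); last first.
    by move=> st; rewrite !inE.
  apply: eq_bigr => st _.
  rewrite -sum1_card [RHS]big_mkcond /= [RHS](reindex_inj (mulgI (block_perm st))) /=.
  by apply: eq_bigr => s _; case: (_ \in _).
have := bin_fact (leq_addr m t); rewrite addKn => binE.
apply/eqP; rewrite -(eqn_pmul2l (m := t`! * m`!)) ?muln_gt0 ?fact_gt0 //.
by rewrite -eq2 eq1 -binE ['C(_, _) * (_ * _)]mulnC -!mulnA.
Qed.

End Split.

(** Prescribing the patterns of the first [t] and the last [m] entries leaves free only the
    comparison across the cut, which has index [t.-1]; its two outcomes are the two terms on the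
    left. *)
Lemma beta_pat_toggle t m (D : nat -> bool) : 0 < t -> 0 < m ->
  beta_pat (t + m) D + beta_pat (t + m) (toggle t.-1 D)
  = 'C(t + m, t) * (beta_pat t D * beta_pat m (fun i => D (t + i))).
Proof.
move=> t_gt0 m_gt0; rewrite -card_split_patterns /beta_pat -cardsUI.
rewrite [X in _ + X]eq_card0 ?addn0; last first.
  have tm : t.-1 < t + m by lia.
  have tm' : t < t + m by lia.
  move=> s; rewrite !inE; apply/negbTE/negP => /andP[/patternP sD /patternP sD'].
  have := sD' (Ordinal tm) (Ordinal tm'); rewrite sD /= ?prednK //.
  by move=> /(_ erefl); rewrite /toggle eqxx; case: (D _).
apply: eq_card => s; rewrite !inE.
apply/orP/andP => [[]/patternP sD|[/patternP sl /patternP sr]].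
- split; apply/patternP => i j ij; first by rewrite sD.
  by rewrite sD //= ij addnS.
- split; apply/patternP => i j ij; rewrite sD /= /toggle ?ij ?addnS //.
    by rewrite ltn_eqF //; case: j ij => /= j; lia.
  by rewrite gtn_eqF //; lia.
have sP (i j : 'I_(t + m)) : j = i.+1 :> nat -> i != t.-1 :> nat -> (s j < s i) = D i.
  move=> ij it; case: (ltnP i t) => lit.
    have ljt : j < t by lia.
    have := sl (Ordinal lit) (Ordinal ljt) ij.
    have -> : lshift m (Ordinal ljt) = j by apply: val_inj.
    by have -> : lshift m (Ordinal lit) = i by apply: val_inj.
  have li' : i - t < m by case: i {ij it} lit => /= i; lia.
  have lj' : j - t < m by case: j {ij it} => /= j; lia.
  have := sr (Ordinal li') (Ordinal lj').
  have -> : rshift t (Ordinal lj') = j by apply: val_inj => /=; lia.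
  have -> : rshift t (Ordinal li') = i by apply: val_inj => /=; lia.
  by rewrite /= subnKC // => -> //; lia.
have [it it'] : t.-1 < t + m /\ t < t + m by lia.
case: (eqVneq (s (Ordinal it') < s (Ordinal it)) (D t.-1)) => st; [left|right];
  apply/patternP => i j ij; rewrite /toggle; case: (eqVneq (i : nat) t.-1) => [e|ne] //=;
  try exact: sP.
- rewrite e -st; congr (val (s _) < val (s _)); apply: val_inj => //=; lia.
- rewrite e; have -> : i = Ordinal it by apply: val_inj.
  have -> : j = Ordinal it' by apply: val_inj => /=; lia.
  by move: st; case: (D _); case: (s _ < s _).
Qed.

(** * The statistics modulo 2 and modulo p *)

(** A strictly increasing [u] satisfies [i <= u i]; this applies to both [s] and its inverse. *)
Lemma perm_increasing n (s : 'S_n) :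
  (forall i j : 'I_n, j = i.+1 :> nat -> s i < s j) -> s = 1%g.
Proof.
move=> s_step.
have s_mono (i j : 'I_n) : i < j -> s i < s j.
  move: {2}(nat_of_ord j) (leqnn j) => m; elim: m j => [|m IHm] j jm ij; first lia.
  have jn : j.-1 < n by have := ltn_ord j; lia.
  have step : s (Ordinal jn) < s j by apply: s_step => /=; lia.
  have [e|ne] := eqVneq (i : nat) j.-1.
    by rewrite (_ : i = Ordinal jn) //; apply: val_inj.
  by apply: ltn_trans step; apply: IHm => /=; lia.
have ge_id (u : 'S_n) : (forall i j : 'I_n, i < j -> u i < u j) -> forall i : 'I_n, i <= u i.
  move=> u_mono i; case: i => m; elim: m => [|m IHm] mn //=.
  have mn' : m < n by lia.
  by apply: leq_ltn_trans (IHm mn') _; apply: u_mono => /=.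
have sV_mono (i j : 'I_n) : i < j -> (s^-1)%g i < (s^-1)%g j.
  move=> ij; rewrite ltnNge leq_eqVlt; apply/negP => /orP[/eqP/val_inj/perm_inj ji|/s_mono].
    by move: ij; rewrite ji ltnn.
  by rewrite !permKV => ji; move: ij; rewrite ltnNge ltnW.
apply/permP => i; rewrite perm1; apply: val_inj; apply/eqP; rewrite eqn_leq ge_id // andbT.
by have := ge_id _ sV_mono (s i); rewrite permK.
Qed.

Lemma beta_pat_ascending n (D : nat -> bool) :
  (forall i, i < n.-1 -> ~~ D i) -> beta_pat n D = 1.
Proof.
move=> D0; apply/eqP/cards1P; exists 1%g; apply/setP => s; rewrite !inE.
apply/patternP/eqP => [sD|-> i j ij]; last first.
  by rewrite !perm1 ij; have /negbTE -> := D0 i ltac:(have := ltn_ord j; lia); lia.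
apply: perm_increasing => i j ij; have /negbTE Di := D0 i ltac:(have := ltn_ord j; lia).
have := sD i j ij; rewrite Di ltnNge => /negbFE.
rewrite leq_eqVlt => /orP[/eqP/val_inj/perm_inj ij'|//].
by move: ij; rewrite ij' => /n_Sn.
Qed.

(** Induction on the number of descents of [D] at indices in [K] below [N], in the form that suits
    the recurrence [beta_pat_toggle]. *)
Lemma toggle_ind N (K : pred nat) (P : (nat -> bool) -> Prop) :
  (forall D : nat -> bool, (forall i, i < N -> K i -> ~~ D i) -> P D) ->
  (forall (D : nat -> bool) k, k < N -> K k -> D k -> P (toggle k D) -> P D) ->
  forall D, P D.
Proof.
move=> P0 PS D; move: {2}(\sum_(i < N | K i) D i) (leqnn (\sum_(i < N | K i) D i)) => m.
elim: m D => [|m IHm] D Dm.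
  apply: P0 => i iN Ki; move: Dm; rewrite (bigD1 (Ordinal iN)) //=.
  by case: (D i).
have [/existsP[k /andP[Kk Dk]]|no] := boolP [exists k : 'I_N, K k && D k].
  apply: (PS D k) => //; apply: IHm.
  rewrite -ltnS; apply: leq_trans Dm.
  rewrite [X in _ < X](bigD1 k) //= Dk (bigD1 k) //= /toggle eqxx Dk /= add0n add1n ltnS.
  apply: leq_sum => i /andP[_ /negbTE ik]; rewrite (_ : (i == k :> nat) = false) //.
apply: P0 => i iN Ki; apply: contra no => Di; apply/existsP; exists (Ordinal iN).
by rewrite Ki.
Qed.

Lemma even_bin_odd n k : odd k -> ~~ odd 'C(n.*2, k).
Proof.
case: k => // k k_odd.
have e := mul_bin_diag n.*2 k.
have : odd (n.*2 * 'C(n.*2.-1, k)) = odd (k.+1 * 'C(n.*2, k.+1)) by rewrite e.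
by rewrite !oddM k_odd odd_double andTb => <-.
Qed.

Lemma odd_bin_double n k : odd 'C(n.*2, k.*2) = odd 'C(n, k).
Proof.
elim: n k => [|n IHn] [|k]; rewrite ?bin0 ?doubleS ?bin0n //.
rewrite !binS !oddD -!doubleS !IHn.
have /negbTE -> : ~~ odd 'C(n.*2, k.*2.+1) by apply: even_bin_odd; rewrite /= odd_double.
by rewrite addbF /= addbC; case: (odd _); case: (odd _).
Qed.

(** Both sides obey the same recurrence modulo 2. Toggling an even index [k] cuts at the odd
    position [k.+1], where the binomial coefficient is even, so neither side changes. Toggling
    [k = x.*2.+1] matches toggling [x] on the right: the binomial coefficients agree modulo 2, and
    the shorter factors agree by induction on [n]. *)
Lemma odd_beta_pat_double n (D : nat -> bool) :
  odd (beta_pat n.*2 D) = odd (beta_pat n (fun i => D i.*2.+1)).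
Proof.
elim/ltn_ind: n D => n IHn D.
elim/(@toggle_ind n.*2.-1 predT): D => [D D0|D k kn _ Dk IH].
  rewrite !beta_pat_ascending // => i ilt; apply: D0 => //; lia.
have := @beta_pat_toggle k.+1 (n.*2 - k.+1) D isT ltac:(lia).
rewrite subnKC /=; last lia.
have [k_odd|k_even] := boolP (odd k).
  have [x kx] : exists x, k = x.*2.+1 by exists k./2; rewrite -[LHS]odd_double_half k_odd.
  have nk : n.*2 - k.+1 = (n - x.+1).*2 by lia.
  rewrite nk (_ : k.+1 = x.+1.*2); last by rewrite kx.
  have := @beta_pat_toggle x.+1 (n - x.+1) (fun i => D i.*2.+1) isT ltac:(lia).
  rewrite subnKC /=; last lia.
  move=> /(congr1 odd) e1 /(congr1 odd) e2.
  rewrite oddD in e1; rewrite oddD in e2.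
  have tE : odd (beta_pat n.*2 (toggle k D))
      = odd (beta_pat n (toggle x (fun i => D i.*2.+1))).
    rewrite IH; congr odd; apply: eq_beta_pat => i _; rewrite /toggle; congr (_ (+) _).
    by rewrite kx eqSS -!mul2n eqn_pmul2l.
  rewrite tE in e2; apply: (@addIb (odd (beta_pat n (toggle x (fun i => D i.*2.+1))))).
  rewrite e2 e1 [LHS]oddM [RHS]oddM odd_bin_double [odd (_ * _)]oddM [in RHS]oddM.
  have [xn nxn] : x.+1 < n /\ n - x.+1 < n by clear -kx kn; lia.
  rewrite !IHn //; congr (_ && (_ && odd _)).
  by apply: eq_beta_pat => i _; rewrite doubleD addnS.
move=> /(congr1 odd); rewrite oddD oddM (negbTE (even_bin_odd _ _)) /= ?k_even //.
move/negbT; rewrite negb_add => /eqP ->; rewrite IH.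
congr odd; apply: eq_beta_pat => i _; rewrite /toggle; case: eqP => // ik.
by move: k_even; rewrite -ik /= odd_double.
Qed.

(** From k C(N, k) = N C(N - 1, k - 1) with N = a p^r: if p does not divide C(N, k), then p^r
    divides k. *)
Lemma prime_dvd_bin_mul_exp p a r k :
  prime p -> 0 < k -> ~~ (p ^ r %| k) -> p %| 'C(a * p ^ r, k).
Proof.
case: k => // k p_pr _ ndvd; apply: contraR ndvd => ndvd.
rewrite -(@Gauss_dvdl _ _ 'C(a * p ^ r, k.+1)); last by rewrite coprimeXl ?prime_coprime.
by rewrite -mul_bin_diag -mulnA mulnCA dvdn_mulr.
Qed.

Section PrimePower.
Variables p r : nat.
Hypothesis p_pr : prime p.
Let q := p ^ r.

Local Open Scope ring_scope.

Lemma Fp_natr_eq0 n : (p %| n)%N -> n%:R = 0 :> 'F_p.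
Proof. by move=> pn; apply/eqP; rewrite -(dvdn_pcharf (pchar_Fp p_pr)). Qed.

Let q_gt0 : (0 < q)%N. Proof. by rewrite expn_gt0 prime_gt0. Qed.

(** In Vandermonde's sum of C(q, i) C(q, q - i), only the terms i = 0 and i = q survive modulo p. *)
Lemma natr_bin_central : 'C(q + q, q)%:R = 2 :> 'F_p.
Proof.
rewrite -binomial.Vandermonde natr_sum big_ord_recr /= (bigD1 (Ordinal q_gt0)) //=.
rewrite bin0 subn0 !binn subnn bin0 big1 ?addr0 // => i i0.
apply: Fp_natr_eq0; rewrite dvdn_mulr //.
have := @prime_dvd_bin_mul_exp p 1 r i p_pr; rewrite mul1n; apply.
  by rewrite lt0n.
by apply/negP => /dvdn_leq; rewrite -/q lt0n leqNgt ltn_ord => /(_ i0).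
Qed.

Lemma natr_beta_pat_toggle t m (D : nat -> bool) :
  (0 < t)%N -> (0 < m)%N -> (p %| 'C(t + m, t))%N ->
  (beta_pat (t + m) D)%:R = - (beta_pat (t + m) (toggle t.-1 D))%:R :> 'F_p.
Proof.
move=> t_gt0 m_gt0 pC; apply/eqP; rewrite -addr_eq0 -natrD beta_pat_toggle //.
by rewrite natrM Fp_natr_eq0 // mul0r.
Qed.

(** Cutting at a position other than q gives a binomial coefficient divisible by p, so toggling
    there changes the sign. What remains is a pattern with no descent except possibly at q, whose
    count is 1 or C(2q, q) - 1, both congruent to 1. *)
Lemma natr_beta_pat_double_ppow (D : nat -> bool) :
  (beta_pat (q + q) D)%:R = \prod_(i < (q + q).-1 | i != q.-1 :> nat) (-1) ^+ D i :> 'F_p.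
Proof.
elim/(@toggle_ind (q + q).-1 (fun i => i != q.-1)): D => [D D0|D k kq kK Dk IH].
  rewrite big1 => [|i iq]; last by rewrite (negbTE (D0 i _ _)).
  have [Dq|Dq] := boolP (D q.-1); last first.
    rewrite beta_pat_ascending // => i ilt; have [->//|ne] := eqVneq i q.-1.
    exact: D0.
  have := beta_pat_toggle D q_gt0 q_gt0.
  rewrite [X in (_ + X)%N]beta_pat_ascending; last first.
    by move=> i ilt; rewrite /toggle; case: eqP => [->|/eqP ne]; [rewrite Dq | apply: D0].
  rewrite [X in _ = (_ * (X * _))%N]beta_pat_ascending; last by move=> i ilt; apply: D0; lia.
  rewrite [X in _ = (_ * (_ * X))%N]beta_pat_ascending; last by move=> i ilt; apply: D0; lia.
  move=> /(congr1 (fun n => n%:R : 'F_p)); rewrite natrD natrM natr_bin_central mulr1 => e.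
  by rewrite -[LHS](addrK 1) e addrK.
have := @natr_beta_pat_toggle k.+1 (q + q - k.+1) D isT ltac:(lia).
rewrite subnKC; last lia.
move=> ->; last first.
  rewrite addnn -mul2n; apply: prime_dvd_bin_mul_exp => //.
  apply/negP => /dvdnP[[|[|c]]] e; [lia| |]; move: kK kq; rewrite -/q in e.
    by rewrite mul1n in e; rewrite -e eqxx.
  by rewrite !mulSn in e; lia.
rewrite /= IH (bigD1 (Ordinal kq)) //= [in RHS](bigD1 (Ordinal kq)) //=.
rewrite /toggle eqxx Dk expr0 mul1r expr1 mulN1r; congr (- _).
by apply: eq_bigr => i /andP[_ /negbTE ik]; rewrite (_ : (i == k :> nat) = false).
Qed.

End PrimePower.

Local Open Scope ring_scope.

(** * Character sums over descent sets *)

Lemma eq_opp_rat_eq0 (x : rat) : x = - x -> x = 0.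
Proof. by move=> xN; apply/eqP; rewrite -eqNr -xN. Qed.

Section Characters.
Variable T : finType.
Implicit Types X Y S : {set T}.

(** The Walsh characters of the cube of subsets: (-1)^|X cap S|. *)
Definition chi X S : rat := \prod_(i in X) (-1) ^+ (i \in S).

Definition symdiff X Y : {set T} := [set i | (i \in X) (+) (i \in Y)].

Lemma symdiffA : associative symdiff.
Proof. by move=> X Y Z; apply/setP => i; rewrite !inE addbA. Qed.

Lemma symdiffxx X : symdiff X X = set0.
Proof. by apply/setP => i; rewrite !inE addbb. Qed.

Lemma symdiff0 X : symdiff X set0 = X.
Proof. by apply/setP => i; rewrite !inE addbF. Qed.

Lemma symdiffK Y : involutive (symdiff^~ Y).
Proof. by move=> X; rewrite -symdiffA symdiffxx symdiff0. Qed.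

Lemma symdiffC : commutative symdiff.
Proof. by move=> X Y; apply/setP => i; rewrite !inE addbC. Qed.

Lemma chiC X S : chi X S = chi S X.
Proof.
rewrite /chi big_mkcond [RHS]big_mkcond; apply: eq_bigr => i _.
by case: (i \in X); case: (i \in S).
Qed.

Lemma chi_symdiffr X S Y : chi X (symdiff S Y) = chi X S * chi X Y.
Proof. by rewrite -big_split; apply: eq_bigr => i _; rewrite inE signr_addb. Qed.

Lemma chi_symdiffl X Y S : chi (symdiff X Y) S = chi X S * chi Y S.
Proof. by rewrite !(chiC _ S) chi_symdiffr. Qed.

Lemma chi_set1 X i : i \in X -> chi X [set i] = -1.
Proof. by move=> iX; rewrite chiC /chi big_set1 iX. Qed.

(** Toggling [i] in [S] preserves [h] and negates [chi X]. *)
Lemma sum_mul_chi_eq0 (h : {set T} -> rat) X i :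
  i \in X -> (forall S, h (symdiff S [set i]) = h S) -> \sum_S h S * chi X S = 0.
Proof.
move=> iX hi; apply: eq_opp_rat_eq0; rewrite -sumrN.
rewrite [LHS](reindex_inj (inv_inj (symdiffK [set i]))); apply: eq_bigr => S _.
by rewrite hi chi_symdiffr chi_set1 // mulrN1 mulrN.
Qed.

Lemma card_sets : #|{set T}| = (2 ^ #|T|)%N.
Proof. by rewrite -[LHS]cardsT -powersetT card_powerset cardsT. Qed.

Lemma sum_chi X : \sum_S chi X S = if X == set0 then 2 ^+ #|T| else 0.
Proof.
have [->|/set0Pn[i iX]] := eqVneq X set0.
  rewrite (eq_bigr (fun=> 1)); last by move=> S _; rewrite /chi big_set0.
  by rewrite sumr_const card_sets natrX.
rewrite -[RHS](sum_mul_chi_eq0 (h := fun=> 1) iX) //.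
by apply: eq_bigr => S _; rewrite mul1r.
Qed.

(* Parseval: up to the factor [2 ^+ #|T|] the sum is the inner product of the
   two families of character sums. *)
Lemma sum_mul_eq0_chi (h w : {set T} -> rat) :
  (forall X, \sum_S h S * chi X S = 0 \/ \sum_S w S * chi X S = 0) ->
  \sum_S h S * w S = 0.
Proof.
move=> hw; have n0 : (2 ^+ #|T| : rat) != 0 by rewrite expf_neq0.
apply: (mulfI n0); rewrite mulr0.
transitivity (\sum_X (\sum_S h S * chi X S) * (\sum_S w S * chi X S)); last first.
  by rewrite big1 // => X _; case: (hw X) => ->; rewrite ?mul0r ?mulr0.
under [RHS]eq_bigr do rewrite big_distrlr /=.
rewrite exchange_big mulr_sumr; apply: eq_bigr => S _ /=.
rewrite exchange_big (bigD1 S) //= [X in _ + X]big1 ?addr0 => [|S' S'S].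
  transitivity (\sum_(X : {set T}) h S * w S); last first.
    by apply: eq_bigr => X _; rewrite mulrACA -chi_symdiffr symdiffxx chiC /chi big_set0 mulr1.
  by rewrite sumr_const card_sets -[RHS]mulr_natl natrX.
under eq_bigr do rewrite mulrACA -chi_symdiffr chiC.
rewrite -mulr_sumr sum_chi ifN ?mulr0 //.
apply: contra S'S => /eqP e; apply/eqP/esym.
by rewrite -[S](symdiffK S') e symdiffC symdiff0.
Qed.

End Characters.

(** * Block reversals and vanishing sums over permutations *)

Section Flip.
Variable N : nat.

(** For [hi < N], the only case used, the default of [insubd] is never reached. *)
Definition flip lo hi (i : 'I_N) : 'I_N :=
  insubd i (if (lo <= i <= hi)%N then (lo + hi - i)%N else i).

Lemma flipE lo hi (i : 'I_N) : (hi < N)%N ->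
  flip lo hi i = (if (lo <= i <= hi)%N then lo + hi - i else i)%N :> nat.
Proof.
move=> hiN; rewrite /flip; case: ifP => ilh; rewrite val_insubd /= ?if_same //.
by rewrite ifT //; lia.
Qed.

Lemma flipK lo hi : (hi < N)%N -> involutive (flip lo hi).
Proof. by move=> hiN i; apply: val_inj; rewrite /= !flipE //; do 2! case: ifP; lia. Qed.

Lemma card_ord_itv a b : (b <= N)%N -> #|[pred i : 'I_N | a <= i < b]%N| = (b - a)%N.
Proof.
move=> bN; rewrite -sum1_card -(big_mkord (fun i => a <= i < b)%N (fun=> 1%N)).
rewrite -[RHS]muln1 -[RHS]sum_nat_const_nat.
rewrite [RHS](big_nat_widen _ _ N) // [RHS](big_nat_widenl _ 0) //.
by apply: eq_bigl => i; rewrite /= andbC.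
Qed.

End Flip.

Section Run.
Variables (n a b : nat) (Y : {set 'I_n.-1}).
Hypotheses (b_lt : (b < n)%N) (odd_ab : odd (b - a)).
Hypothesis run : forall i : 'I_n.-1, (a <= i < b)%N -> i \in Y.
Hypothesis run_left : forall i : 'I_n.-1, i.+1 = a -> i \notin Y.
Hypothesis run_right : forall i : 'I_n.-1, i = b :> nat -> i \notin Y.

(** Inside this section [rho] denotes the block reversal, not the proportion of odd statistics. *)
Let rho : 'S_n := perm (inv_inj (flipK a b_lt)).

(* Reversing the positions a, ..., b turns each of the b - a comparisons of the
   run into its opposite; the comparisons at a - 1 and b are not in Y. *)
Lemma chi_Des_flip (s : 'S_n) : chi Y (Des (rho * s)%g) = - chi Y (Des s).
Proof.
have ab : (a < b)%N by rewrite -subn_gt0; case: (b - a)%N odd_ab.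
have b1_lt : (b.-1 < n.-1)%N by lia.
rewrite /chi (bigID (fun i : 'I_n.-1 => a <= i < b)%N) /=.
rewrite [in RHS](bigID (fun i : 'I_n.-1 => a <= i < b)%N) /= -mulNr; congr (_ * _).
  have inY (i : 'I_n.-1) : (i \in Y) && (a <= i < b)%N = (a <= i < b)%N.
    by case: (boolP (a <= i < b)%N) => [/run ->|]; rewrite ?andbF.
  rewrite !(eq_bigl _ _ inY).
  rewrite -[RHS]mulN1r -[X in X * _](_ : (-1) ^+ #|[pred i : 'I_n.-1 | a <= i < b]%N| = -1).
    rewrite -prodrN [RHS](reindex_inj (inv_inj (flipK a b1_lt))) /=.
    apply: eq_big => i; first by rewrite inE flipE //; case: ifP; lia.
    move=> iab; rewrite !inE !permM !permE.
    (* The two positions compared at [i] go to those compared at its mirror image in the run, in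
       swapped order. *)
    have -> : flip a b (adjr i) = adjl (flip a b.-1 i).
      by apply: val_inj; rewrite /= !flipE //=; do 2! case: ifP; lia.
    have -> : flip a b (adjl i) = adjr (flip a b.-1 i).
      by apply: val_inj; rewrite /= !flipE //=; do 2! case: ifP; lia.
    set u := adjl _; set v := adjr _.
    have : s u != s v.
      by apply/eqP => /perm_inj /(congr1 val) /=; lia.
    rewrite neq_ltn => /orP[uv|vu].
      by rewrite uv ltnNge ltnW // expr1 expr0.
    by rewrite vu ltnNge ltnW // expr1 expr0 opprK.
  rewrite card_ord_itv; last lia.
  by rewrite -signr_odd odd_ab.
apply: eq_bigr => i /andP[iY iab]; rewrite !inE !permM !permE.
have ia : i.+1 != a by apply/eqP => /run_left; rewrite iY.
have ib : i != b :> nat by apply/eqP => /run_right; rewrite iY.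
by congr ((-1) ^+ (s _ < s _)%N); apply: val_inj; rewrite /= flipE //=; case: ifP; lia.
Qed.

Lemma sum_chi_Des_eq0 : \sum_(s : 'S_n) chi Y (Des s) = 0.
Proof.
apply: eq_opp_rat_eq0; rewrite -sumrN [LHS](reindex_inj (mulgI rho)).
by apply: eq_bigr => s _; rewrite chi_Des_flip.
Qed.

Lemma sum_beta_chi_eq0 : \sum_S (beta S)%:R * chi Y S = 0.
Proof.
rewrite -[RHS]sum_chi_Des_eq0 [RHS](partition_big (@Des n) predT) //=.
apply: eq_bigr => S _; rewrite mulr_natl -sumr_const; apply: eq_big => s.
  by rewrite inE.
by rewrite inE => /eqP ->.
Qed.

End Run.

Definition indicator N (S : {set 'I_N}) (i : nat) : bool :=
  [exists j : 'I_N, (j \in S) && (j == i :> nat)].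

Lemma indicatorE N (S : {set 'I_N}) (i : 'I_N) : indicator S i = (i \in S).
Proof.
apply/existsP/idP => [[j /andP[jS /eqP/val_inj <-]]//|iS].
by exists i; rewrite iS eqxx.
Qed.

Lemma beta_indicator n (S : {set 'I_n.-1}) : beta S = beta_pat n (indicator S).
Proof.
apply: eq_card => s; rewrite !inE; apply/eqP/forallP => [<- i|sS].
  by rewrite indicatorE inE.
by apply/setP => i; rewrite inE (eqP (sS i)) indicatorE.
Qed.

(** * Fourier support of the parity sign on subsets of [2q - 1] *)

Section Double.
Variable q : nat.
Hypothesis q_odd : odd q.

(* Positions are 0-based: the paper's even positions 2j are the odd ordinals, and
   its position q is the ordinal q - 1. *)
Lemma double_pos_proof (j : 'I_q.-1) : (j.*2.+1 < (2 * q).-1)%N.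
Proof. have := ltn_ord j; lia. Qed.

Definition double_pos (j : 'I_q.-1) : 'I_(2 * q).-1 := Ordinal (double_pos_proof j).

Lemma double_pos_inj : injective double_pos.
Proof. by move=> i j /(congr1 val) /= [/double_inj/val_inj]. Qed.

Definition half_set (S : {set 'I_(2 * q).-1}) : {set 'I_q.-1} :=
  [set j | double_pos j \in S].

Lemma odd_beta_half_set (S : {set 'I_(2 * q).-1}) : odd (beta S) = odd (beta (half_set S)).
Proof.
have doubleE D : odd (beta_pat (2 * q) D) = odd (beta_pat q (fun i => D i.*2.+1)).
  by rewrite mul2n odd_beta_pat_double.
rewrite !beta_indicator doubleE.
congr odd; apply: eq_beta_pat => i iq.
rewrite -[i]/(val (Ordinal iq)) (indicatorE _ (Ordinal iq)) inE -indicatorE.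
by [].
Qed.

Definition parity_sign (S : {set 'I_(2 * q).-1}) : rat := (-1) ^+ beta S.

Lemma parity_signE S : parity_sign S = (-1) ^+ beta (half_set S).
Proof. by rewrite /parity_sign -signr_odd odd_beta_half_set signr_odd. Qed.

(** The hypothesis says that (-1)^beta_q sums to 0 over the subsets of [q - 1]. To lift this, the
    sum is averaged over the translates of [S] by even positions: for fixed [S], their half sets run
    once through all subsets. *)
Lemma sum_parity_sign_eq0 : rho q = 1 / 2 -> \sum_S parity_sign S = 0.
Proof.
move=> rho_half.
have two_n0 : 2 ^+ q.-1 != 0 :> rat by rewrite expf_neq0.
have sumB : \sum_(B : {set 'I_q.-1}) (-1) ^+ beta B = 0 :> rat.
  transitivity (\sum_(B : {set 'I_q.-1}) (1 - 2 * (odd (beta B))%:R) : rat).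
    by apply: eq_bigr => B _; rewrite -signr_odd; case: (odd _) => /=; rewrite ?expr1 ?expr0; ring.
  rewrite sumrB sumr_const card_sets card_ord -mulr_sumr -natr_sum natrX.
  have -> : (\sum_(B : {set 'I_q.-1}) odd (beta B))%N = #|[set B : {set 'I_q.-1} | odd (beta B)]|.
    rewrite -sum1_card [RHS]big_mkcond; apply: eq_bigr => B _.
    by rewrite inE; case: (odd _).
  have := congr1 ( *%R^~ (2 ^+ q.-1)) rho_half; rewrite /rho divfK // => ->.
  by field.
apply: (mulfI two_n0); rewrite mulr0.
transitivity (\sum_(B : {set 'I_q.-1}) \sum_S parity_sign (symdiff S (double_pos @: B))).
  transitivity (\sum_(B : {set 'I_q.-1}) \sum_S parity_sign S).
    by rewrite sumr_const card_sets card_ord -[RHS]mulr_natl natrX.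
  apply: eq_bigr => B _.
  by rewrite [LHS](reindex_inj (inv_inj (symdiffK (double_pos @: B)))).
rewrite exchange_big big1 // => S _ /=.
rewrite -[RHS]sumB [RHS](reindex_inj (inv_inj (symdiffK (half_set S)))).
apply: eq_bigr => B _; rewrite parity_signE; congr (_ ^+ beta _).
by apply/setP => j; rewrite !inE (mem_imset _ _ double_pos_inj) addbC.
Qed.

(** An even ordinal is an odd position, which [half_set] does not see. *)
Lemma sum_parity_sign_chi_eq0 (X : {set 'I_(2 * q).-1}) (i : 'I_(2 * q).-1) :
  i \in X -> ~~ odd i -> \sum_S parity_sign S * chi X S = 0.
Proof.
move=> iX i_even; apply: (sum_mul_chi_eq0 iX) => S; rewrite !parity_signE.
congr (_ ^+ beta _); apply/setP => j; rewrite !inE -[RHS]addbF; congr (_ (+) _).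
by apply: contraNF i_even => /eqP <-; rewrite /= odd_double.
Qed.

Definition off_center : {set 'I_(2 * q).-1} := [set i : 'I_(2 * q).-1 | i != q.-1 :> nat].

Section OddPositions.
Variable X : {set 'I_(2 * q).-1}.
Hypothesis X_neq0 : X != set0.
Hypothesis X_odd : forall i : 'I_(2 * q).-1, i \in X -> odd i.

(** All elements of [X] are odd, so none are adjacent and each is a run of length 1. *)
Lemma sum_beta_chi_odd : \sum_S (beta S)%:R * chi X S = 0.
Proof.
have /set0Pn[i iX] := X_neq0.
have i_odd := X_odd iX; have i_lt := ltn_ord i.
apply: (@sum_beta_chi_eq0 _ i i.+1); [lia | by rewrite subSnn | | |].
- by move=> j ij; rewrite (_ : j = i) //; apply: val_inj => /=; lia.
- by move=> j ij; apply/negP => /X_odd; move: i_odd; rewrite -ij /= => /negP.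
- by move=> j ij; apply/negP => /X_odd; rewrite ij /= i_odd.
Qed.

Lemma sum_beta_chi_off_center : \sum_S (beta S)%:R * chi (symdiff off_center X) S = 0.
Proof.
have inY (j : 'I_(2 * q).-1) : j \in symdiff off_center X = (j != q.-1 :> nat) (+) (j \in X).
  by rewrite !inE.
have [i0 i0X] := set0Pn _ X_neq0.
(* If [X] has an element below [q.-1], its least element [M] is odd, and 0, ..., [M - 1] is a
   maximal run of odd length [M]. *)
have [/existsP[i1 /andP[i1X i1q]]|noleft] := boolP [exists i in X, (i < q.-1)%N].
  pose M := [arg min_(i < i1 | (i \in X) && (i < q.-1)%N) (i : nat)].
  have : [/\ M \in X, (M < q.-1)%N & forall j, j \in X -> (M <= j)%N].
    rewrite /M; case: arg_minnP => [|i /andP[iX iq] imin]; first by rewrite i1X.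
    split=> // j jX; have [jq|] := ltnP j q.-1; first by apply: imin; rewrite jX.
    by move=> qj; apply: leq_trans qj; apply: ltnW.
  case: M => i /= iN [iX iq imin]; have i_odd := X_odd iX.
  apply: (@sum_beta_chi_eq0 _ 0 i) => [||j /andP[_ ji]|//|j ji]; [lia|by rewrite subn0| |].
    have -> : j \in symdiff off_center X = (j != q.-1 :> nat).
      by rewrite inY (negbTE (_ : j \notin X)) ?addbF //; apply/negP => /imin; lia.
    by lia.
  rewrite inY (_ : j = Ordinal iN) ?iX /=; last exact: val_inj.
  by rewrite addbT negbK; lia.
(* Otherwise the greatest element [M] lies beyond [q.-1], and the indices after it form a maximal
   run of odd length 2q - 2 - [M]. *)
pose M := [arg max_(i > i0 in X) (i : nat)].
have : M \in X /\ forall j, j \in X -> (j <= M)%N.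
  by rewrite /M; case: arg_maxnP => [//|i iX imax]; split.
case=> MX Mmax; have M_odd := X_odd MX; have Mlt := ltn_ord M.
have Mq : (q.-1 < M)%N.
  have : (q.-1 <= M)%N.
    rewrite leqNgt; apply: contra noleft => Mq; apply/existsP; exists M.
    by rewrite MX.
  by rewrite leq_eqVlt => /orP[/eqP e|//]; move: M_odd q_odd; rewrite -e; case: (q) => //= n ->.
apply: (@sum_beta_chi_eq0 _ M.+1 (2 * q).-1) => [||j /andP[Mj _]|j [jM]|j ji]; first lia.
- by rewrite oddB; lia.
- have -> : j \in symdiff off_center X = (j != q.-1 :> nat).
    by rewrite inY (negbTE (_ : j \notin X)) ?addbF //; apply/negP => /Mmax; lia.
  by lia.
- rewrite inY (_ : j = M) ?MX /=; last exact: val_inj.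
  by rewrite addbT negbK; lia.
- by have := ltn_ord j; rewrite ji ltnn.
Qed.

End OddPositions.

Hypothesis q_gt1 : (1 < q)%N.
Hypothesis rho_half : rho q = 1 / 2.

(** The Fourier transform of [parity_sign] is supported on the nonempty [X] made of odd ordinals, so
    Parseval tests [w] on these only. *)
Lemma sum_parity_sign_mul_eq0 (w : {set 'I_(2 * q).-1} -> rat) :
  (forall X : {set 'I_(2 * q).-1}, X != set0 ->
     (forall i : 'I_(2 * q).-1, i \in X -> odd i) -> \sum_S w S * chi X S = 0) ->
  \sum_S parity_sign S * w S = 0.
Proof.
move=> wX; apply: sum_mul_eq0_chi => X.
have [->|X0] := eqVneq X set0.
  left; rewrite -[RHS](sum_parity_sign_eq0 rho_half).
  by apply: eq_bigr => S _; rewrite /chi big_set0 mulr1.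
have [/existsP[i /andP[iX i_even]]|no] := boolP [exists i in X, ~~ odd i].
  by left; apply: sum_parity_sign_chi_eq0 i_even.
right; apply: wX => // i iX; apply: contraNT no => i_even.
by apply/existsP; exists i; rewrite iX.
Qed.

(** For [e] equal to 1 or -1, the factor [1 + e * chi off_center S] is twice the indicator of a
    class. *)
Lemma sum_parity_sign_class (e : rat) :
  \sum_S parity_sign S * (1 + e * chi off_center S) = 0.
Proof.
apply: sum_parity_sign_mul_eq0 => X X0 X_odd.
transitivity (\sum_S chi X S + e * \sum_S chi (symdiff off_center X) S).
  by rewrite mulr_sumr -big_split; apply: eq_bigr => S _ /=; rewrite chi_symdiffl; ring.
(* Ordinal 0 shows the symmetric difference nonempty: it is even, hence outside [X], and differs
   from [q.-1] because [1 < q]. *)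
have pos0 : (0 < (2 * q).-1)%N by lia.
rewrite !sum_chi (negbTE X0) ifN ?mulr0 ?addr0 //.
apply/set0Pn; exists (Ordinal pos0); rewrite !inE /=.
rewrite (contraNF (X_odd (Ordinal pos0))) // addbF; lia.
Qed.

Lemma sum_beta_parity_sign_class (e : rat) :
  \sum_S parity_sign S * ((beta S)%:R * (1 + e * chi off_center S)) = 0.
Proof.
apply: sum_parity_sign_mul_eq0 => X X0 X_odd.
transitivity (\sum_S (beta S)%:R * chi X S
              + e * \sum_S (beta S)%:R * chi (symdiff off_center X) S).
  by rewrite mulr_sumr -big_split; apply: eq_bigr => S _ /=; rewrite chi_symdiffl; ring.
by rewrite sum_beta_chi_odd // sum_beta_chi_off_center // mulr0 addr0.
Qed.

End Double.

(** * Divisibility *)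

Lemma exprB1_expansion (R : comNzRingType) (u : R) k :
  exists v, (u - 1) ^+ k = (-1) ^+ k * (1 - k%:R * u) + u ^+ 2 * v.
Proof.
elim: k => [|k [v IHv]]; first by exists 0; ring.
by exists ((u - 1) * v - (-1) ^+ k * k%:R); rewrite exprS IHv -[k.+1]addn1 natrD exprD; ring.
Qed.

Lemma Xn_plus1_sqr_dvd_sum (I : finType) (P : pred I) (b : I -> nat) (p c : nat) :
  (0 < p)%N -> odd p -> (forall i, P i -> b i = c %[mod p]) ->
  \sum_(i | P i) (-1) ^+ (b i) = 0 :> rat ->
  \sum_(i | P i) (b i)%:R * (-1) ^+ (b i) = 0 :> rat ->
  ('X^p + 1) ^+ 2 %| \sum_(i | P i) ('X^(b i) : {poly rat}).
Proof.
move=> p_gt0 p_odd bc sum0 sum1.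
pose d := (c %% p)%N; pose k i := (b i %/ p)%N.
have bE i : P i -> b i = (p * k i + d)%N.
  by move=> Pi; rewrite /d -(bc i Pi) mulnC -divn_eq.
have signE i : P i -> (-1) ^+ (k i) = (-1) ^+ d * (-1) ^+ (b i) :> rat.
  move=> Pi; rewrite (bE i Pi) exprD mulrCA -expr2 sqrr_sign mulr1.
  by rewrite -[LHS]signr_odd -[RHS]signr_odd oddM p_odd.
have sumk0 : \sum_(i | P i) (-1) ^+ (k i) = 0 :> rat.
  by rewrite (eq_bigr _ signE) -mulr_sumr sum0 mulr0.
have sumk1 : \sum_(i | P i) (-1) ^+ (k i) * (k i)%:R = 0 :> rat.
  have p_neq0 : (p%:R : rat) != 0 by rewrite pnatr_eq0 -lt0n.
  apply: (mulfI p_neq0); rewrite mulr0 mulr_sumr.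
  transitivity (\sum_(i | P i) ((-1) ^+ d * ((b i)%:R * (-1) ^+ (b i))
                               - d%:R * (-1) ^+ (k i)) : rat).
    apply: eq_bigr => i Pi; have : (b i)%:R = p%:R * (k i)%:R + d%:R :> rat.
      by rewrite [in LHS](bE i Pi) natrD natrM.
    by rewrite signE // => ->; ring.
  by rewrite sumrB -!mulr_sumr sum1 sumk0 !mulr0 subr0.
set u := 'X^p + 1; have Xp : 'X^p = u - 1 by rewrite addrK.
(* [w i] is the reduction of ['X^(p * k i)] modulo [u ^+ 2]; by the two hypotheses these sum to 0
   and can be subtracted. *)
pose w i : {poly rat} := ((-1) ^+ (k i))%:P - ((-1) ^+ (k i) * (k i)%:R)%:P * u.
have w_sum : \sum_(i | P i) w i = 0.
  by rewrite sumrB -mulr_suml -!rmorph_sum sumk0 sumk1 !rmorph0 mul0r subr0.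
have -> : \sum_(i | P i) 'X^(b i) = \sum_(i | P i) 'X^d * ('X^(p * k i) - w i).
  rewrite -mulr_sumr sumrB w_sum subr0 mulr_sumr.
  by apply: eq_bigr => i Pi; rewrite (bE i Pi) exprD mulrC.
apply: (big_ind (fun x => u ^+ 2 %| x)) => [|x y|i _]; [exact: dvdp0 | exact: dvdp_add |].
have [v e] := exprB1_expansion u (k i).
rewrite exprM Xp e /w polyCM rmorph_sign polyC_natr.
by apply: dvdp_mull; apply/dvdpP; exists v; ring.
Qed.

(** Dividing X^(2p) - 1 = Phi_1 Phi_p Phi_2 Phi_2p by X^p - 1 = Phi_1 Phi_p leaves Phi_2 Phi_2p =
    X^p + 1. *)
Lemma Phi_double_prime_dvd p : prime p -> odd p -> Phi (2 * p) %| 'X^p + 1.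
Proof.
move=> p_pr p_odd; have p_gt0 := prime_gt0 p_pr.
have p_neq2 : p != 2 by apply: contraL p_odd => /eqP ->.
have e1 : 'Phi_1 * 'Phi_p = 'X^p - 1 :> {poly int}.
  rewrite -prod_Cyclotomic // [RHS](perm_big [:: 1; p]%N) /=.
    by rewrite !big_cons big_nil mulr1.
  apply: uniq_perm => [||d]; rewrite ?divisors_uniq //=.
    by rewrite inE eq_sym neq_ltn prime_gt1 ?orbT.
  rewrite -dvdn_divisors // !inE; apply/idP/orP => [|[/eqP->|/eqP->]]; rewrite ?dvd1n //.
  by case/primeP: p_pr => _ dP /dP /pred2P[]->; rewrite eqxx; [left|right].
have e2 : 'Phi_1 * 'Phi_p * ('Phi_2 * 'Phi_(2 * p)) = 'X^(2 * p) - 1 :> {poly int}.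
  rewrite -prod_Cyclotomic ?muln_gt0 // [RHS](perm_big [:: 1; p; 2; 2 * p]%N) /=.
    by rewrite !big_cons big_nil mulr1 !mulrA.
  apply: uniq_perm => [||d]; rewrite ?divisors_uniq //=.
    rewrite !inE !negb_or; have := prime_gt1 p_pr; lia.
  rewrite -dvdn_divisors ?muln_gt0 // !inE.
  apply/idP/idP; last first.
    case/or4P => /eqP ->; [exact: dvd1n | exact: dvdn_mull | exact: dvdn_mulr | exact: dvdnn].
  have [/dvdnP[e ->]|npd] := boolP (p %| d)%N.
    rewrite dvdn_pmul2r // => /[dup] /(@dvdn_leq _ 2 isT).
    by case: e => [|[|[|]]] //; rewrite ?mul0n ?mul1n ?eqxx ?orbT //.
  rewrite Gauss_dvdl; last by rewrite coprime_sym prime_coprime.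
  by move=> /[dup] /(@dvdn_leq _ 2 isT); case: d {npd} => [|[|[|]]] //; rewrite eqxx !orbT.
have Xp_neq0 : 'X^p - 1 != 0 :> {poly int} by rewrite monic_neq0 ?monicXnsubC.
have : 'Phi_2 * 'Phi_(2 * p) = 'X^p + 1 :> {poly int}.
  apply: (mulfI Xp_neq0); rewrite -[in LHS]e1 e2 mulnC exprM; ring.
move/(congr1 (map_poly (intr : int -> rat))).
rewrite rmorphM rmorphD rmorph1 /= map_polyXn -/(Phi _) => <-.
exact: dvdp_mulIr.
Qed.

(** * The two residue classes modulo p and the conclusion *)

Definition off_center_size q (S : {set 'I_(2 * q).-1}) : nat :=
  \sum_(i in off_center q) (i \in S).

Lemma chi_off_center q (S : {set 'I_(2 * q).-1}) :
  chi (off_center q) S = (-1) ^+ odd (off_center_size S).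
Proof. by rewrite /chi prodrXr signr_odd. Qed.

Lemma Fp_natr_beta p r (S : {set 'I_(2 * p ^ r).-1}) : prime p ->
  (beta S)%:R = (-1) ^+ odd (off_center_size S) :> 'F_p.
Proof.
move=> p_pr.
have e D : (beta_pat (2 * p ^ r) D)%:R
    = \prod_(i < (2 * p ^ r).-1 | i != (p ^ r).-1 :> nat) (-1) ^+ D i :> 'F_p.
  by rewrite mul2n -addnn natr_beta_pat_double_ppow.
rewrite beta_indicator e signr_odd -prodrXr; apply: eq_big => i; first by rewrite inE.
by rewrite indicatorE.
Qed.

Lemma Xn_plus1_sqr_dvd_class p r (c : bool) :
  prime p -> odd p -> (0 < r)%N -> rho (p ^ r) = 1 / 2 ->
  ('X^p + 1) ^+ 2
    %| (\sum_(S : {set 'I_(2 * p ^ r).-1} | odd (off_center_size S) == c) 'X^(beta S)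
        : {poly rat}).
Proof.
move=> p_pr p_odd r_gt0 rho_half.
set q := (p ^ r)%N; have q_odd : odd q by rewrite oddX p_odd orbT.
have q_gt1 : (1 < q)%N by rewrite -(exp1n r) ltn_exp2r // prime_gt1.
have classE (F : {set 'I_(2 * q).-1} -> rat) :
    \sum_S F S * (1 + (-1) ^+ c * chi (off_center q) S)
    = 2 * \sum_(S | odd (off_center_size S) == c) F S.
  rewrite mulr_sumr [RHS]big_mkcond; apply: eq_bigr => S _.
  by rewrite chi_off_center; case: (odd _); case: c => /=; rewrite ?expr1 ?expr0; ring.
have class_eq0 (F : {set 'I_(2 * q).-1} -> rat) :
    \sum_S F S * (1 + (-1) ^+ c * chi (off_center q) S) = 0 ->
    \sum_(S | odd (off_center_size S) == c) F S = 0.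
  by rewrite classE => /eqP; rewrite mulf_eq0 pnatr_eq0 => /eqP.
(* The common residue of the exponents is the representative of (-1)^c in ['F_p]. *)
apply: (@Xn_plus1_sqr_dvd_sum _ _ _ p (val ((-1) ^+ c : 'F_p))) => //.
- exact: prime_gt0.
- move=> S /eqP <-; rewrite -(Fp_natr_beta S p_pr) /= val_Fp_nat //.
  by rewrite modn_mod.
- exact/class_eq0/sum_parity_sign_class.
apply: class_eq0; rewrite -[RHS](sum_beta_parity_sign_class q_odd rho_half ((-1) ^+ c)).
by apply: eq_bigr => S _; rewrite mulrA [parity_sign S * _]mulrC.
Qed.

Theorem theorem8p1 (p r q : nat) (p_prime : prime p) (p_odd : odd p)
    (r_gt0 : (0 < r)%N) (q_def : q = (p ^ r)%N) (rho_q : rho q = 1 / 2) :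
  Phi (2 * p) ^+ 2 %| descent_poly (2 * q).
Proof.
rewrite {}q_def in rho_q *; apply: dvdp_trans (_ : ('X^p + 1) ^+ 2 %| _).
  by apply: dvdp_exp2r; apply: Phi_double_prime_dvd.
pose P (c : bool) (S : {set 'I_(2 * p ^ r).-1}) := odd (off_center_size S) == c.
have -> : descent_poly (2 * p ^ r)
    = \sum_(S | P true S) 'X^(beta S) + \sum_(S | P false S) 'X^(beta S).
  rewrite [LHS](bigID (P true)) /=; congr (_ + _).
  by apply: eq_bigl => S; rewrite /P; case: (odd _).
by apply: dvdp_add; apply: Xn_plus1_sqr_dvd_class.
Qed.
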